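(* Let $X$ and $Y$ be random elements defined on a common probability space, with values in arbitrary measurable spaces, and let $m\ge 0$ be an integer. Let $D_m(X:Y)$ be the index of $m$-dependence of $X$ from $Y$. Then $D_m(X:Y)=0$ if and only if there is a linear subspace $S\subseteq L^2(Y)$ of dimension at most $m+1$ such that $E\{\varphi(X)\mid Y\}\in S$ for every $\varphi(X)\in L^2(X)$.
   Context: $L^2(X)$ denotes the Hilbert space of real random variables $\varphi(X)$, with $\varphi$ measurable, such that $E|\varphi(X)|^2<\infty$ (random variables equal almost surely are identified). Its inner product is $(\varphi_1,\varphi_2)=E\{\varphi_1(X)\varphi_2(X)\}$. The space $L^2(Y)$ is defined in the same way. $E\{\cdot\mid Y\}$ is conditional expectation given the $\sigma$-algebra generated by $Y$. For square-integrable real random variables $\xi_0,\ldots,\xi_m$, let $V(\xi_0,\ldots,\xi_m)$ be the $(m+1)\times(m+1)$ covariance matrix of the vector $(\xi_0,\ldots,\xi_m)$, and let $|V|$ denote the determinant of $V$. The index of $m$-dependence of $X$ from $Y$ is $$D_m(X:Y)=\sup\,|V(\phi_0(Y),\phi_1(Y),\ldots,\phi_m(Y))|,\qquad \phi_i(Y)=E\{\varphi_i(X)\mid Y\},$$ where the supremum is taken over all $\varphi_0(X),\ldots,\varphi_m(X)\in L^2(X)$ whose covariance matrix $V(\varphi_0(X),\ldots,\varphi_m(X))$ is the identity matrix of order $m+1$. If no such tuple exists, the supremum is taken to be $0$. *)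

(* Defs.v *)
From HB Require Import structures.
From mathcomp Require Import all_boot all_order all_algebra.
From mathcomp Require Import all_classical all_reals all_analysis.
From mathcomp Require Import measurable_realfun.

Set Implicit Arguments.
Unset Strict Implicit.
Unset Printing Implicit Defensive.

Import Order.TTheory GRing.Theory Num.Theory.
Import numFieldNormedType.Exports.

Local Open Scope classical_set_scope.
Local Open Scope ring_scope.

Section L2.
Context (R : realType) (d : measure_display) (T : measurableType d)
  (P : probability T R).

(** [L^2(Z)] is the union of its almost-sure classes: a square-integrable random
    variable belongs to it when its class contains some [phi(Z)]. *)
Definition L2 (d' : measure_display) (TZ : measurableType d')
    (Z : {RV P >-> TZ}) : set (T -> R) :=
  [set xi | xi \in Lfun P 2%:E /\
            exists phi : {mfun TZ >-> R}, xi = phi \o Z %[ae P]].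

(** A subspace of [L^2(Z)], again as the union of its classes, hence closed
    under almost-sure equality. *)
Definition L2_subspace (d' : measure_display) (TZ : measurableType d')
    (Z : {RV P >-> TZ}) (S : set (T -> R)) : Prop :=
  [/\ S `<=` L2 Z,
      S (cst 0),
      (forall (a : R) xi eta, S xi -> S eta -> S (a *: xi + eta)) &
      (forall xi eta, S xi -> L2 Z eta -> xi = eta %[ae P] -> S eta)].

(** Linear combinations are taken modulo almost-sure equality, and the family
    need not be free. *)
Definition dim_le (S : set (T -> R)) (n : nat) : Prop :=
  exists b : 'I_n -> T -> R,
    (forall i, S (b i)) /\
    (forall xi, S xi ->
      exists c : 'I_n -> R, xi = \sum_(i < n) c i *: b i %[ae P]).

Definition is_condexp (d' : measure_display) (TY : measurableType d')
    (Y : {RV P >-> TY}) (xi eta : T -> R) : Prop :=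
  [/\ measurable_fun [set: g_sigma_algebra_preimageType Y] eta,
      P.-integrable [set: T] (EFin \o eta) &
      forall A : set (g_sigma_algebra_preimageType Y), measurable A ->
        (\int[P]_(w in A) (eta w)%:E = \int[P]_(w in A) (xi w)%:E)%E].

(** A chosen version of [E{xi | Y}]; the value [cst 0] is only used when [xi] is
    not integrable. *)
Definition condexp (d' : measure_display) (TY : measurableType d')
    (Y : {RV P >-> TY}) (xi : T -> R) : T -> R :=
  xget (cst 0) [set eta | is_condexp Y xi eta].

Lemma condexp_spec (d' : measure_display) (TY : measurableType d')
    (Y : {RV P >-> TY}) (xi : T -> R) :
  P.-integrable [set: T] (EFin \o xi) -> is_condexp Y xi (condexp Y xi).
Proof.
move=> ixi; rewrite /condexp; suff [eta] : exists eta, is_condexp Y xi eta.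
  by move=> h; apply: (xgetPex (cst 0)); exists eta.
pose mY : measurable_fun [set: T] Y := measurable_funPT Y.
pose nu0 : {charge set TY -> \bar R} :=
  pushforward (induced_charge ixi) Y.
pose nu := nu0 mY.
have dom : nu `<< distribution P Y.
  apply: dominates_pushforward => //; apply/null_content_dominatesP => A mA PA.
  have mxi := measurable_int _ ixi.
  by apply: (null_set_integral mA) => //; exact: measurable_funTS.
pose f := Radon_Nikodym nu (distribution P Y).
have ffin w : f w \is a fin_num by exact: Radon_Nikodym_fin_num.
have intf : (distribution P Y).-integrable [set: TY] f.
  exact: Radon_Nikodym_integrable.
have fE A : measurable A -> nu A = (\int[distribution P Y]_(x in A) f x)%E.
  exact: Radon_Nikodym_integral.
have mf := measurable_int _ intf.
have mfY : measurable_fun [set: T] (f \o Y) by exact: measurableT_comp.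
have fY w : (fine (f (Y w)))%:E = f (Y w) by rewrite fineK.
have ifY : P.-integrable [set: T] (f \o Y).
  apply/integrableP; split => //.
  case/integrableP : intf => _; apply: le_lt_trans.
  rewrite ge0_integral_pushforward//.
  by apply: measurableT_comp.
exists (fine \o f \o Y); split.
- move=> _ B mB; rewrite setTI.
  exists ((fine \o f) @^-1` B) => //; last by rewrite setTI.
  rewrite -[X in measurable X]setTI.
  have : measurable_fun [set: TY] (fine \o f) by apply: measurableT_comp.
  by apply.
- apply: eq_integrable ifY => // w _; exact/esym/fY.
- move=> _ [B mB <-]; rewrite setTI.
  transitivity (\int[P]_(w in Y @^-1` B) ((f \o Y) w))%E.
    by apply: eq_integral => w _; rewrite /= fY.
  rewrite -(@integral_pushforward _ _ _ _ _ _ mY)//.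
    by rewrite -fE.
  by apply: (integrableS measurableT) => //; exact: measurable_funPTI.
Qed.

Definition cov_mx (n : nat) (xi : 'I_n -> T -> R) : 'M[R]_n :=
  \matrix_(i, j) fine (covariance P (xi i) (xi j)).

Section index.
Context (dX dY : measure_display) (TX : measurableType dX)
  (TY : measurableType dY) (X : {RV P >-> TX}) (Y : {RV P >-> TY}).

Definition dependence_dets (m : nat) : set (\bar R) :=
  [set (\det (cov_mx (fun i => condexp Y (phi i))))%:E |
    phi in [set phi : 'I_m.+1 -> T -> R |
             (forall i, L2 X (phi i)) /\ cov_mx phi = 1%:M]].

(** The supremum of an empty family is [0] here, whereas [ereal_sup set0] is
    [-oo]. *)
Definition dependence_index (m : nat) : \bar R :=
  if dependence_dets m == set0 then 0%E else ereal_sup (dependence_dets m).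

End index.
End L2.

(* Main.v *)
Require Import Defs.
From HB Require Import structures.
From mathcomp Require Import all_boot all_order all_algebra.
From mathcomp Require Import all_classical all_reals all_analysis.
From mathcomp Require Import measurable_realfun lra.

Set Implicit Arguments.
Unset Strict Implicit.
Unset Printing Implicit Defensive.

Import Order.TTheory GRing.Theory Num.Theory.
Import numFieldNormedType.Exports.

Local Open Scope classical_set_scope.
Local Open Scope ring_scope.

(** The covariance matrix of a family in [L^2] is singular iff some nontrivial
    linear combination of the family is almost surely constant.  Hence a
    singular covariance of the [phi_i(X)] forces a singular covariance of the
    [E{phi_i(X) | Y}], and otherwise the [phi_i(X)] can be normalized by an
    invertible matrix, which multiplies the determinant of the conditional
    expectations by a nonzero square.  So [D_m = 0] iff every [m + 1]
    conditional expectations have a nontrivial combination that is constant,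
    that is, iff the conditional expectations and the constants span a space
    of dimension at most [m + 1]. *)

(** * Normalization of positive definite matrices by congruence *)

(** Gaussian elimination on the first row and column: a congruence brings [M] to the block diagonal
    of its corner entry [a] and the Schur complement [S], which is again symmetric and positive
    definite. Induction normalizes [S], and the inverse square root of [a] normalizes the corner. *)
Lemma posdef_mx_normalize (F : rcfType) (n : nat) (M : 'M[F]_n) :
  M^T = M -> (forall v : 'rV_n, v != 0 -> 0 < (v *m M *m v^T) 0 0) ->
  exists A : 'M[F]_n, A *m M *m A^T = 1%:M.
Proof.
elim: n => [|n IHn] in M *.
  by move=> _ _; exists 1%:M; rewrite [LHS]flatmx0 [RHS]flatmx0.
rewrite -[n.+1]/(1 + n)%N in M * => symM posM.
pose a := ulsubmx M 0 0; pose b := ursubmx M; pose D := drsubmx M.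
have defM : M = block_mx a%:M b b^T D.
  rewrite -[LHS]submxK; congr block_mx; first exact: mx11_scalar.
  by rewrite -{1}symM -trmx_ursub.
have a_gt0 : 0 < a.
  (* The corner entry is the value of the form at the first unit vector. *)
  have := posM (row_mx 1%:M 0); rewrite defM tr_row_mx mul_row_block.
  rewrite !mul0mx !addr0 !mul1mx mul_row_col trmx0 mulmx0 addr0 trmx1 mulmx1.
  rewrite mxE eqxx mulr1n; apply; apply/negP => /eqP/matrixP/(_ 0 (lshift n 0)).
  by rewrite row_mxEl !mxE eqxx => /eqP; rewrite oner_eq0.
have a_neq0 : a != 0 by rewrite gt_eqF.
pose c := - a^-1 *: b^T.
pose B : 'M[F]_(1 + n) := block_mx 1%:M 0 c 1%:M.
pose S := D - a^-1 *: (b^T *m b).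
have BMB : B *m M *m B^T = block_mx a%:M 0 0 S.
  rewrite defM tr_block_mx trmx0 !trmx1 !mulmx_block.
  rewrite !mul1mx !mul0mx !mulmx0 !mulmx1 !addr0.
  have -> : a%:M *m c^T + b = 0.
    rewrite mul_scalar_mx /c linearZ /= trmxK scalerA mulrN divff// scaleN1r.
    by rewrite addNr.
  have -> : c *m a%:M + b^T = 0.
    by rewrite mul_mx_scalar /c scalerA mulrN divff// scaleN1r addNr.
  by rewrite mul0mx add0r /c -scalemxAl scaleNr addrC.
have symS : S^T = S.
  rewrite /S linearB linearZ /= trmx_mul trmxK; congr (_ - _).
  by rewrite /D -{2}symM trmx_drsub.
have [|A AS] := IHn S symS.
  (* The form of [S] at [w] is the form of [M] at [(0, w) B], a nonzero vector because its right
     block is [w]. *)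
  move=> w w0; have := posM (row_mx 0 w *m B).
  rewrite trmx_mul -!mulmxA (mulmxA M) (mulmxA B) (mulmxA B) BMB.
  rewrite tr_row_mx mul_block_col !mul_row_col trmx0 !mulmx0 !mul0mx !add0r.
  rewrite mulmxA; apply; apply: contraNneq w0.
  by rewrite mul_mx_row mulmx1 -[RHS]row_mx0 => /eq_row_mx[_ ->].
pose A1 : 'M[F]_(1 + n) := block_mx (Num.sqrt a)^-1%:M 0 0 A.
exists (A1 *m B).
rewrite trmx_mul -!mulmxA (mulmxA M) (mulmxA B) (mulmxA B) BMB.
rewrite /A1 tr_block_mx !trmx0 tr_scalar_mx !mulmx_block.
rewrite !mulmx0 !mul0mx !addr0 !add0r !mulmx0 (mulmxA A) AS -!scalar_mxM.
rewrite -{2}(sqr_sqrtr (ltW a_gt0)) expr2 mulfK; last first.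
  by rewrite gt_eqF ?sqrtr_gt0.
by rewrite mulVf ?scalar_mx_block// gt_eqF ?sqrtr_gt0.
Qed.

(** * Covariance matrices of families in L^2 and their singularity *)

Section covariance_of_families.
Context (R : realType) (d : measure_display) (T : measurableType d)
  (P : probability T R).
Implicit Types (f g : T -> R).

Local Notation L := (Lfun P 2%:E).

Let le12 : (1 <= 2%:E :> \bar R)%E. Proof. by rewrite lee_fin ler1n. Qed.

Lemma Lfun2_lin a f g : f \in L -> g \in L -> a *: f + g \in L.
Proof. by move=> fL gL; apply: rpredD => //=; apply: rpredZ. Qed.

Lemma Lfun2_sum (n : nat) (c : 'I_n -> R) (f : 'I_n -> T -> R) :
  (forall i, f i \in L) -> \sum_(i < n) c i *: f i \in L.
Proof. by move=> fL; apply: rpred_sum => //= i _; apply: rpredZ. Qed.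


Lemma Lfun2_measurable f : f \in L -> measurable_fun [set: T] f.
Proof. by move=> /sub_Lfun_mfun; rewrite inE. Qed.

Lemma Lfun2_Lfun1 f : f \in L -> f \in Lfun P 1.
Proof. by move=> fL; apply: Lfun_subset12 => //; exact: fin_num_measure. Qed.

Lemma Lfun2_integrable f : f \in L -> P.-integrable [set: T] (EFin \o f).
Proof. by move=> /Lfun2_Lfun1/Lfun1_integrable. Qed.

Lemma covariance_ae f g h : measurable_fun [set: T] f ->
  measurable_fun [set: T] g -> measurable_fun [set: T] h ->
  f = g %[ae P] -> covariance P f h = covariance P g h.
Proof.
move=> mf mg mh fg.
have Efg : ('E_P[f] = 'E_P[g])%E.
  rewrite expectation.unlock; apply: ae_eq_integral => //.
  - exact: measurableT_comp.
  - exact: measurableT_comp.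
  - exact: (ae_eq_comp EFin).
rewrite covariance.unlock Efg expectation.unlock; apply: ae_eq_integral => //.
- by apply/measurable_EFinP; apply: measurable_funM; exact: measurable_funB.
- by apply/measurable_EFinP; apply: measurable_funM; exact: measurable_funB.
- by apply: filterS fg => x /(_ I) fgx _; rewrite /= !fctE /= fgx.
Qed.

Lemma covariance_lin a f g h : f \in L -> g \in L -> h \in L ->
  fine (covariance P (a *: f + g) h) =
  a * fine (covariance P f h) + fine (covariance P g h).
Proof.
move=> fL gL hL.
have f1 := Lfun2_Lfun1 fL; have g1 := Lfun2_Lfun1 gL.
have h1 := Lfun2_Lfun1 hL.
have fh := Lfun2_mul_Lfun1 fL hL; have gh := Lfun2_mul_Lfun1 gL hL.
have -> : a *: f + g = (a \o* f) \+ g.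
  by apply/funext => x /=; rewrite fctE /= mulrC.
rewrite covarianceDl// ?Lfun_scale ?ler1n// covarianceZl// fineD ?fineM//.
all: by rewrite ?fin_numM// covariance_fin_num.
Qed.

Lemma covariance_suml (n : nat) (c : 'I_n -> R) (f : 'I_n -> T -> R) h :
  (forall i, f i \in L) -> h \in L ->
  fine (covariance P (\sum_(i < n) c i *: f i) h) =
  \sum_(i < n) c i * fine (covariance P (f i) h).
Proof.
(* The induction carries membership in [L] of the partial sums, which [covariance_lin] requires. *)
move=> fL hL; pose K g r := g \in L /\ fine (covariance P g h) = r.
suff [] : K (\sum_(i < n) c i *: f i)
            (\sum_(i < n) c i * fine (covariance P (f i) h)) by [].
apply: (big_rec2 K) => [|i g r _ [gL gr]].
  by split; [exact: rpred0|rewrite (_ : 0 = cst 0)// covariance_cst_l].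
by split; [exact: Lfun2_lin|rewrite covariance_lin// gr].
Qed.

Lemma cov_mx_mulmx (k n : nat) (A : 'M[R]_(k, n)) (f : 'I_n -> T -> R) :
  (forall i, f i \in L) ->
  cov_mx P (fun i : 'I_k => \sum_(j < n) A i j *: f j) =
  A *m cov_mx P f *m A^T.
Proof.
move=> fL; apply/matrixP => i j; rewrite -mulmxA mxE [RHS]mxE.
rewrite covariance_suml//; last exact: Lfun2_sum.
apply: eq_bigr => l _; congr (_ * _).
rewrite covarianceC covariance_suml// mxE; apply: eq_bigr => l' _.
by rewrite !mxE mulrC covarianceC mulrC.
Qed.

Lemma variance0_cst f : f \in L -> fine (covariance P f f) = 0 ->
  exists c, f = cst c %[ae P].
Proof.
move=> fL; have mf := Lfun2_measurable fL.
have cfin : covariance P f f \is a fin_num.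
  apply: covariance_fin_num; try exact: Lfun2_Lfun1.
  exact: Lfun2_mul_Lfun1.
move=> c0; have {}c0 : covariance P f f = 0%E by rewrite -(fineK cfin) c0.
set c := fine ('E_P[f])%E; exists c; move: c0.
have -> : covariance P f f = (\int[P]_x `|((f x - c) ^+ 2)%:E|)%E.
  rewrite covariance.unlock -/c expectation.unlock; apply: eq_integral => x _.
  by rewrite gee0_abs ?lee_fin ?sqr_ge0 // expr2.
have msq : measurable_fun [set: T] (EFin \o (fun x => (f x - c) ^+ 2)).
  by apply/measurable_EFinP/measurable_funX; exact: measurable_funB.
move=> /(ae_eq_integral_abs P measurableT msq).1.
apply: filterS => x /(_ I) /= [] /eqP fx _; apply/eqP.
by rewrite sqrf_eq0 subr_eq0 in fx.
Qed.

Lemma cov_mx_tr (n : nat) (f : 'I_n -> T -> R) : (cov_mx P f)^T = cov_mx P f.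
Proof. by apply/matrixP => i j; rewrite !mxE covarianceC. Qed.

Lemma eq_cov_mx_ae (n : nat) (f g : 'I_n -> T -> R) :
  (forall i, measurable_fun [set: T] (f i)) ->
  (forall i, measurable_fun [set: T] (g i)) ->
  (forall i, f i = g i %[ae P]) -> cov_mx P f = cov_mx P g.
Proof.
move=> mf mg fg; apply/matrixP => i j; rewrite !mxE.
rewrite (covariance_ae (mf i) (mg i))// covarianceC.
by rewrite (covariance_ae (mf j) (mg j))// covarianceC.
Qed.

Lemma cov_mx_quadratic (n : nat) (f : 'I_n -> T -> R) (v : 'rV_n) :
  (forall i, f i \in L) ->
  (v *m cov_mx P f *m v^T) 0 0 =
  fine (covariance P (\sum_(i < n) v 0 i *: f i) (\sum_(i < n) v 0 i *: f i)).
Proof. by move=> fL; rewrite -cov_mx_mulmx// mxE. Qed.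

(** If [v] annihilates the covariance matrix, the combination with coefficients [v] has variance
    zero, hence is almost surely constant. Conversely, a constant has zero covariance with each
    [f j], and these covariances are the entries of [v] times the matrix. *)
Lemma det_cov_mx_eq0P (n : nat) (f : 'I_n -> T -> R) :
  (forall i, f i \in L) ->
  (\det (cov_mx P f) = 0 <->
   exists v : 'rV_n, v != 0 /\
     exists c, \sum_(i < n) v 0 i *: f i = cst c %[ae P]).
Proof.
move=> fL; split=> [/eqP/det0P[v v0 vM]|[v [v0 [c fc]]]].
  exists v; split => //; apply: variance0_cst; first exact: Lfun2_sum.
  by rewrite -cov_mx_quadratic// vM mul0mx mxE.
apply/eqP/det0P; exists v => //; apply/rowP => j; rewrite !mxE.
under eq_bigr do rewrite mxE.
rewrite -covariance_suml//.
rewrite (covariance_ae _ _ _ fc) ?covariance_cst_l//.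
- exact/Lfun2_measurable/Lfun2_sum.
- exact: Lfun2_measurable.
Qed.

(** The quadratic form of the covariance matrix is a variance, hence nonnegative; a zero at some
    [v != 0] would make a nontrivial combination constant and the determinant zero. *)
Lemma cov_mx_normalize (n : nat) (f : 'I_n -> T -> R) :
  (forall i, f i \in L) -> \det (cov_mx P f) != 0 ->
  exists A : 'M[R]_n, A *m cov_mx P f *m A^T = 1%:M.
Proof.
move=> fL detf; apply: posdef_mx_normalize; first exact: cov_mx_tr.
move=> v v0; rewrite cov_mx_quadratic// lt0r; apply/andP; split.
  apply: contra detf => /eqP /variance0_cst [|c fc]; first exact: Lfun2_sum.
  by apply/eqP/det_cov_mx_eq0P => //; exists v; split=> //; exists c.
exact/fine_ge0/variance_ge0.
Qed.

End covariance_of_families.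

(** * Linearity and almost sure uniqueness of conditional expectation *)

Section conditional_expectation.
Context (R : realType) (d dY : measure_display) (T : measurableType d)
  (TY : measurableType dY) (P : probability T R) (Y : {RV P >-> TY}).
Implicit Types (xi eta : T -> R).

Local Notation integrable xi := (P.-integrable [set: T] (EFin \o xi)).
Local Notation sigmaY := (g_sigma_algebra_preimageType Y).
Local Notation L := (Lfun P 2%:E).

Lemma sigmaY_measurable (A : set sigmaY) :
  measurable A -> measurable (A : set T).
Proof. by case=> B mB <-; exact: measurable_funPT. Qed.

Lemma sigmaY_measurable_fun eta :
  measurable_fun [set: sigmaY] eta -> measurable_fun [set: T] eta.
Proof. by move=> m _ B mB; apply/sigmaY_measurable/m. Qed.

Lemma sigmaY_measurable_preimage eta (B : set R) :
  measurable_fun [set: sigmaY] eta -> measurable B ->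
  measurable (eta @^-1` B : set sigmaY).
Proof. by move=> m mB; rewrite -[X in measurable X]setTI; exact: m. Qed.

Lemma integrable_lin a xi eta :
  integrable xi -> integrable eta -> integrable (a *: xi + eta).
Proof.
move=> ixi ieta; have iaxi := integrableZl measurableT a ixi.
by apply: eq_integrable (integrableD measurableT iaxi ieta).
Qed.

Lemma integral_lin (A : set T) a xi eta : measurable A ->
  integrable xi -> integrable eta ->
  (\int[P]_(w in A) ((a *: xi + eta) w)%:E =
   a%:E * \int[P]_(w in A) (xi w)%:E + \int[P]_(w in A) (eta w)%:E)%E.
Proof.
move=> mA ixi ieta.
have ixiA : P.-integrable A (EFin \o xi) by exact: integrableS ixi.
have ietaA : P.-integrable A (EFin \o eta) by exact: integrableS ieta.
by rewrite -integralZl// -integralD//; exact: integrableZl.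
Qed.

Lemma is_condexp_lin a xi xi' eta eta' : integrable xi -> integrable xi' ->
  is_condexp Y xi eta -> is_condexp Y xi' eta' ->
  is_condexp Y (a *: xi + xi') (a *: eta + eta').
Proof.
move=> ixi ixi' [me ie He] [me' ie' He']; split.
- by apply: measurable_funD => //; exact: measurable_funM.
- exact: integrable_lin.
- move=> A mA; have mA' := sigmaY_measurable mA.
  by rewrite !integral_lin// He// He'.
Qed.

Lemma is_condexp_cst xi c : measurable_fun [set: T] xi ->
  xi = cst c %[ae P] -> is_condexp Y xi (cst c).
Proof.
move=> mxi xic; split; first exact: measurable_cst.
  exact: finite_measure_integrable_cst.
move=> A mA; have mA' := sigmaY_measurable mA.
apply: ae_eq_integral => //.
- exact/measurable_EFinP/measurable_funTS.
- exact/measurable_EFinP/measurable_funTS.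
- by apply: filterS xic => w /(_ I) xiw _; rewrite xiw.
Qed.

Lemma is_condexp_sum (n : nat) (c : 'I_n -> R) (xi eta : 'I_n -> T -> R) :
  (forall i, integrable (xi i)) -> (forall i, is_condexp Y (xi i) (eta i)) ->
  is_condexp Y (\sum_(i < n) c i *: xi i) (\sum_(i < n) c i *: eta i).
Proof.
move=> ixi H; pose K f g := integrable f /\ is_condexp Y f g.
suff [] : K (\sum_(i < n) c i *: xi i) (\sum_(i < n) c i *: eta i) by [].
apply: (big_rec2 K) => [|i f g _ [fi fg]].
  split; first exact: (finite_measure_integrable_cst P 0).
  apply: (@is_condexp_cst 0 0); first exact: (@measurable_cst _ _ T R setT 0).
  exact: (ae_eq_refl P setT (0 : T -> R)).
by split; [exact: integrable_lin|exact: is_condexp_lin].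
Qed.

(** The sets where [eta] is nonnegative and where it is nonpositive belong to the sigma-algebra of
    [Y]. On each, the integral of [|eta|] is that of [eta] up to sign, hence zero. *)
Lemma is_condexp0_ae eta : is_condexp Y (cst 0) eta -> eta = cst 0 %[ae P].
Proof.
move=> [me ie He]; have me' := sigmaY_measurable_fun me.
have zero (B : set R) : measurable B ->
    B `<=` [set x | 0 <= x] \/ B `<=` [set x | x <= 0] ->
    eta = cst 0 %[ae P in eta @^-1` B].
  move=> mB Bs.
  have mA := sigmaY_measurable_preimage me mB; have mA' := sigmaY_measurable mA.
  have mE : measurable_fun (eta @^-1` B) (EFin \o eta).
    exact/measurable_EFinP/measurable_funTS.
  have : (\int[P]_(w in eta @^-1` B) `|(EFin \o eta) w| = 0)%E.
    have := He _ mA; rewrite integral0 => E0.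
    case: Bs => Bs.
      rewrite -[RHS]E0; apply: eq_integral => w; rewrite inE => /Bs /= w0.
      by rewrite ger0_norm.
    transitivity (\int[P]_(w in eta @^-1` B) (- (eta w)%:E))%E.
      apply: eq_integral => w; rewrite inE => /Bs /= w0.
      by rewrite ler0_norm.
    rewrite integralN ?E0 ?oppe0//.
    exact/integrable_add_def/(integrableS _ _ _ ie).
  move/(ae_eq_integral_abs P mA' mE).1; apply: filterS => w h wB.
  by have [] := h wB.
have ge0 : eta = cst 0 %[ae P in eta @^-1` `[0, +oo[%classic].
  by apply: zero => //; left => x /=; rewrite in_itv/= andbT.
have le0 : eta = cst 0 %[ae P in eta @^-1` `]-oo, 0]%classic].
  by apply: zero => //; right => x /=; rewrite in_itv.
apply: filterS2 ge0 le0 => w h1 h2 _; have [w0|/ltW w0] := leP 0 (eta w).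
- by apply: h1; rewrite /= in_itv/= w0.
- by apply: h2; rewrite /= in_itv.
Qed.

Lemma is_condexp_unique xi eta eta' : integrable xi ->
  is_condexp Y xi eta -> is_condexp Y xi eta' -> eta = eta' %[ae P].
Proof.
move=> ixi H H'; have := is_condexp_lin (-1) ixi ixi H' H.
rewrite scaleN1r addNr => /is_condexp0_ae; apply: filterS => w /(_ I) h _.
apply/eqP; rewrite -subr_eq0 -[X in _ == X]h; apply/eqP.
by rewrite [RHS](_ : _ = -1 * eta' w + eta w)// mulN1r addrC.
Qed.

(** * Square integrability and factorization through [Y] *)

(** A crude form of the conditional Jensen inequality, enough for finiteness. The set where [eta] is
    nonnegative is cut by the integer part of [eta] into countably many events of the sigma-algebra
    of [Y], and a single affine function serves on each slice. Using [2 t^2 + 2] in place of [t^2]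
    absorbs the unit width of the slices. *)
Lemma integral_sqr_condexp_nonneg xi eta : xi \in L -> is_condexp Y xi eta ->
  (\int[P]_(w in eta @^-1` `[0%R, +oo[) ((eta w) ^+ 2)%:E <=
   \int[P]_w (2 * (xi w) ^+ 2 + 2)%:E)%E.
Proof.
move=> xiL [me ie He]; have ixi := Lfun2_integrable xiL.
have mxi := Lfun2_measurable xiL; have me' := sigmaY_measurable_fun me.
have msq : measurable_fun [set: T] (EFin \o (fun w => eta w ^+ 2)).
  exact/measurable_EFinP/measurable_funX.
have mB : measurable_fun [set: T] (EFin \o (fun w => 2 * xi w ^+ 2 + 2)).
  apply/measurable_EFinP/measurable_funD => //.
  by apply/measurable_funM => //; exact: measurable_funX.
have B0 w : (0 <= (2 * xi w ^+ 2 + 2)%:E)%E.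
  by rewrite lee_fin addr_ge0// mulr_ge0// sqr_ge0.
pose A := eta @^-1` `[0, +oo[%classic.
(* [Num.truncn] sends negative numbers to 0, so the intersection with [A] keeps them out of the
   slice [k = 0]. *)
pose F k := A `&` (Num.truncn \o eta) @^-1` [set k].
have FE k : F k = eta @^-1` `[k%:R, k.+1%:R[%classic.
  apply/seteqP; split=> w; rewrite /F /A /= !in_itv/= ?andbT.
    by move=> [w0 <-]; exact: truncn_itv.
  move=> /[dup] kw /truncn_def ->; split => //.
  by case/andP : kw => + _; apply: le_trans.
have mF k : measurable (F k : set sigmaY).
  by rewrite FE; exact: sigmaY_measurable_preimage.
have mFT k := sigmaY_measurable (mF k).
have AF : A = \bigcup_k F k.
  apply/seteqP; split=> [w wA|w [k _ []//]].
  by exists (Num.truncn (eta w)).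
have tF : trivIset [set: nat] F by exact: trivIset_preimage1_in.
have mA : measurable (A : set T) by rewrite AF; exact: bigcupT_measurable.
apply: (@le_trans _ _ (\int[P]_(w in A) (2 * xi w ^+ 2 + 2)%:E)%E); last first.
  by apply: ge0_subset_integral.
rewrite -/A AF !ge0_integral_bigcup//; last 3 first.
- exact: measurable_funTS.
- exact: measurable_funTS.
- by move=> w _; rewrite lee_fin sqr_ge0.
apply: lee_nneseries => [k _ _|k _].
  by apply: integral_ge0 => w _; rewrite lee_fin sqr_ge0.
(* On [F k] both sides are compared with the tangent of [2 t^2 + 2] at [t = k],
   which is affine, so that its integral is the same for [eta] and [xi]. *)
pose a : R := 4 * k%:R; pose b : R := 2 - 2 * k%:R ^+ 2.
have ib : integrable (cst b) by exact: finite_measure_integrable_cst.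
apply: (@le_trans _ _ (\int[P]_(w in F k) ((a *: eta + cst b) w)%:E)%E).
  apply: ge0_le_integral => //.
  - by move=> w _; rewrite lee_fin sqr_ge0.
  - exact: measurable_funTS.
  - apply: measurable_int; apply: (integrableS measurableT) => //.
    exact: (integrable_lin a ie ib).
  - move=> w; rewrite FE /= in_itv/= lee_fin -natr1 => /andP[h1 h2].
    rewrite [leRHS](_ : _ = a * eta w + b)// /a /b.
    have k0 : 0 <= k%:R :> R by [].
    move: (k%:R : R) (eta w) h1 h2 k0 => x y h1 h2 k0.
    have : 0 <= x * (y - x) by rewrite mulr_ge0// subr_ge0.
    by nra.
rewrite integral_lin// He// -integral_lin//.
apply: le_integral => //.
- apply: (integrableS measurableT) => //.
  exact: (integrable_lin a ixi ib).
- apply: (integrableS measurableT) => //.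
  have isq : integrable (fun w => xi w ^+ 2) by exact: Lfun2_integrable_sqr.
  have i2 : integrable (cst (2 : R)) by exact: finite_measure_integrable_cst.
  exact: (integrable_lin 2 isq i2).
- move=> w _; rewrite lee_fin [leLHS](_ : _ = a * xi w + b)// /a /b.
  by have := sqr_ge0 (xi w - k%:R); nra.
Qed.

(** The previous bound controls [eta ^ 2] where [eta] is nonnegative. Applied to [- xi], with
    conditional expectation [- eta], it controls the rest. *)
Lemma is_condexp_Lfun2 xi eta : xi \in L -> is_condexp Y xi eta -> eta \in L.
Proof.
move=> xiL H; have [me ie He] := H; have me' := sigmaY_measurable_fun me.
have ixi := Lfun2_integrable xiL.
have H0 := is_condexp_cst (measurable_cst (0 : R)) (ae_eq_refl _ _ _).
have i0 : integrable (cst 0) by exact: finite_measure_integrable_cst.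
(* The negatives are written [-1 *: xi + cst 0] and [-1 *: eta + cst 0] to fit the shape of
   [is_condexp_lin]. *)
have HN := is_condexp_lin (-1) ixi i0 H H0.
have xiNL : -1 *: xi + cst 0 \in L by rewrite Lfun2_lin// Lfun_cst.
have msq : measurable_fun [set: T] (EFin \o (fun w => eta w ^+ 2)).
  exact/measurable_EFinP/measurable_funX.
have bnd f : f \in L -> (\int[P]_w (2 * (f w) ^+ 2 + 2)%:E < +oo)%E.
  move=> fL; apply: integrable_lty => //.
  have isq : integrable (fun w => f w ^+ 2) by exact: Lfun2_integrable_sqr.
  have i2 : integrable (cst (2 : R)) by exact: finite_measure_integrable_cst.
  exact: (integrable_lin 2 isq i2).
have mge : measurable (eta @^-1` `[0, +oo[%classic).
  by apply/sigmaY_measurable/sigmaY_measurable_preimage.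
have mlt : measurable (eta @^-1` `]-oo, 0[%classic).
  by apply/sigmaY_measurable/sigmaY_measurable_preimage.
have fin : (\int[P]_w (eta w ^+ 2)%:E < +oo)%E.
  have -> : [set: T] = eta @^-1` `[0, +oo[ `|` eta @^-1` `]-oo, 0[.
    apply/seteqP; split=> // w _ /=; rewrite !in_itv/= andbT.
    by have [|] := leP 0 (eta w); [left|right].
  rewrite ge0_integral_setU//; last 3 first.
  - exact: measurable_funTS.
  - by move=> w _; rewrite lee_fin sqr_ge0.
  - apply/disj_setPS => w [] /=; rewrite !in_itv/= andbT => h1 h2.
    by have := le_lt_trans h1 h2; rewrite ltxx.
  apply: lte_add_pinfty.
    exact: le_lt_trans (integral_sqr_condexp_nonneg xiL H) (bnd _ xiL).
  apply: le_lt_trans (bnd _ xiNL).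
  apply: le_trans (integral_sqr_condexp_nonneg xiNL HN).
  under [leRHS]eq_integral.
    by move=> w _; rewrite (_ : _ ^+ 2 = eta w ^+ 2); [over|
      rewrite [X in X ^+ 2](_ : _ = -1 * eta w + 0)// addr0 mulN1r sqrrN].
  apply: ge0_subset_integral => //.
  - by apply/sigmaY_measurable/sigmaY_measurable_preimage => //; case: HN.
  - exact: measurable_funTS.
  - by move=> w _; rewrite lee_fin sqr_ge0.
  - move=> w /=; rewrite !in_itv/= andbT => /ltW w0.
    by rewrite [leRHS](_ : _ = -1 * eta w + 0)// addr0 mulN1r oppr_ge0.
rewrite inE; apply/andP; split; rewrite inE//=.
rewrite /finite_norm unlock /Lnorm poweR_lty//.
under eq_integral => w _ /= do
  rewrite powR_mulrn// -normrX ger0_norm ?sqr_ge0//.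
exact: fin.
Qed.

(** Take for [phi] the density, with respect to the law of [Y], of the image under [Y] of the signed
    measure with [P]-density [xi]. This supplies the function of [Y] that membership in [L2 Y] asks
    for; uniqueness then transfers it to the version chosen by [condexp]. *)
Lemma is_condexp_factor xi : integrable xi ->
  exists phi : {mfun TY >-> R}, is_condexp Y xi (phi \o Y).
Proof.
move=> ixi; have mY : measurable_fun [set: T] Y := measurable_funPT Y.
pose nu0 : {charge set TY -> \bar R} := pushforward (induced_charge ixi) Y.
pose nu := nu0 mY.
have dom : nu `<< distribution P Y.
  apply: dominates_pushforward => //; apply/null_content_dominatesP => A mA PA.
  apply: (null_set_integral mA) => //.
  exact: measurable_funTS (measurable_int _ ixi).
pose f := Radon_Nikodym nu (distribution P Y).
have mf : measurable_fun [set: TY] f.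
  exact: measurable_int (Radon_Nikodym_integrable dom).
have mphi : measurable_fun [set: TY] (fine \o f) by exact: measurableT_comp.
pose phi : {mfun TY >-> R} := HB.pack (fine \o f)
  (@isMeasurableFun.Build _ _ TY R (fine \o f) mphi).
have fE w : ((fine \o f) w)%:E = f w.
  by rewrite /= fineK// Radon_Nikodym_fin_num.
have fY : integrable (phi \o Y).
  apply: (eq_integrable measurableT (f \o Y)) => [w _|].
    by rewrite /= -fE.
  apply/integrableP; split; first exact: measurableT_comp.
  have /integrableP[_] := Radon_Nikodym_integrable dom.
  apply: le_lt_trans; rewrite ge0_integral_pushforward//.
  exact: measurableT_comp.
exists phi; split => //.
- move=> _ B mB; rewrite setTI; exists ((fine \o f) @^-1` B); last first.
    by rewrite setTI.
  by rewrite -[X in measurable X]setTI; exact (mphi measurableT B mB).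
- move=> _ [B mB <-].
  rewrite setTI -[RHS]/(nu B) (Radon_Nikodym_integral dom mB).
  rewrite integral_pushforward//; first by apply: eq_integral => w _; exact: fE.
  apply: (integrableS measurableT) => //.
    exact: measurable_funPTI.
  by apply: eq_integrable fY => // w _; exact: fE.
Qed.

Lemma condexp_L2 xi : xi \in L -> L2 Y (condexp Y xi).
Proof.
move=> xiL; have ixi := Lfun2_integrable xiL; have H := condexp_spec Y ixi.
split; first exact: is_condexp_Lfun2 H.
have [phi Hphi] := is_condexp_factor ixi.
by exists phi; exact: is_condexp_unique Hphi.
Qed.

Lemma condexp_sum_ae (n : nat) (c : 'I_n -> R) (xi : 'I_n -> T -> R) :
  (forall i, xi i \in L) ->
  condexp Y (\sum_(i < n) c i *: xi i) = \sum_(i < n) c i *: condexp Y (xi i)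
    %[ae P].
Proof.
move=> xiL; have ixi i := Lfun2_integrable (xiL i).
have isum := Lfun2_integrable (Lfun2_sum c xiL).
apply: is_condexp_unique (isum) (condexp_spec Y isum) _.
by apply: is_condexp_sum => // i; exact: condexp_spec.
Qed.

Lemma condexp_cst_ae xi c : xi \in L -> xi = cst c %[ae P] ->
  condexp Y xi = cst c %[ae P].
Proof.
move=> xiL xic; have ixi := Lfun2_integrable xiL.
apply: is_condexp_unique (ixi) (condexp_spec Y ixi) _.
exact: is_condexp_cst (Lfun2_measurable xiL) xic.
Qed.

End conditional_expectation.

(** * Vanishing of the index and the span of the conditional expectations *)

Section dependence_index_zero.
Context (R : realType) (d dX dY : measure_display) (T : measurableType d)
  (TX : measurableType dX) (TY : measurableType dY) (P : probability T R)
  (X : {RV P >-> TX}) (Y : {RV P >-> TY}).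
Implicit Types (xi eta : T -> R).

Local Notation L := (Lfun P 2%:E).

Lemma L2_lin (dZ : measure_display) (TZ : measurableType dZ) (Z : {RV P >-> TZ})
  a xi eta : L2 Z xi -> L2 Z eta -> L2 Z (a *: xi + eta).
Proof.
move=> [xiL [phi Hphi]] [etaL [psi Hpsi]]; split; first exact: Lfun2_lin.
exists (a *: phi + psi); apply: filterS2 Hphi Hpsi => w /(_ I) h1 /(_ I) h2 _.
by rewrite [LHS](_ : _ = a * xi w + eta w)// h1 h2.
Qed.

Lemma L2_cst (dZ : measure_display) (TZ : measurableType dZ) (Z : {RV P >-> TZ})
  (c : R) : L2 Z (cst c).
Proof.
split; first exact: Lfun_cst.
by exists (cst c : {mfun TZ >-> R}); apply/aeW.
Qed.

Lemma cov_mx_condexp_mulmx (k n : nat) (A : 'M[R]_(k, n))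
    (xi : 'I_n -> T -> R) :
  (forall i, xi i \in L) ->
  cov_mx P (fun i : 'I_k => condexp Y (\sum_(j < n) A i j *: xi j)) =
  A *m cov_mx P (fun j => condexp Y (xi j)) *m A^T.
Proof.
move=> xiL.
have cL j : condexp Y (xi j) \in L by have [] := condexp_L2 Y (xiL j).
rewrite -cov_mx_mulmx//; apply: eq_cov_mx_ae => i.
- have sL : \sum_(j < n) A i j *: xi j \in L by exact: Lfun2_sum.
  by have [/Lfun2_measurable] := condexp_L2 Y sL.
- exact/Lfun2_measurable/Lfun2_sum.
- exact: condexp_sum_ae.
Qed.

(** Conditional expectation is linear and fixes constants, so a constant combination of the [xi i]
    stays constant, with the same coefficients, after conditioning. *)
Lemma det_cov_mx_condexp_neq0 (n : nat) (xi : 'I_n -> T -> R) :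
  (forall i, xi i \in L) ->
  \det (cov_mx P (fun i => condexp Y (xi i))) != 0 -> \det (cov_mx P xi) != 0.
Proof.
move=> xiL; apply: contra_neq => /(det_cov_mx_eq0P xiL)[v [v0 [c vc]]].
apply/det_cov_mx_eq0P; first by move=> i; have [] := condexp_L2 Y (xiL i).
exists v; split => //; exists c.
apply: ae_eq_trans (ae_eq_sym (condexp_sum_ae Y _ xiL)) _.
by apply: condexp_cst_ae => //; exact: Lfun2_sum.
Qed.

(** A normalizing matrix [A] makes the determinant times [\det A ^+ 2] equal to 1. *)
Lemma det_cov_mx_gt0 (n : nat) (f : 'I_n -> T -> R) : (forall i, f i \in L) ->
  \det (cov_mx P f) != 0 -> 0 < \det (cov_mx P f).
Proof.
move=> fL f0; have [A /(congr1 determinant)] := cov_mx_normalize fL f0.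
rewrite !det_mulmx det_tr det1 mulrAC -expr2 => A1.
rewrite lt0r f0/= -(@pmulr_rge0 _ (\det A ^+ 2)) ?A1 ?ler01//.
rewrite exprn_even_gt0//=; apply: contra_eqN A1 => /eqP ->.
by rewrite expr0n mul0r eq_sym oner_eq0.
Qed.

(** Frees the vanishing from the normalization: a tuple with nonzero determinant could be normalized
    within [L2 X] and would then contribute a positive number to a supremum equal to 0. *)
Lemma det_cov_mx_condexp_eq0 (m : nat) (xi : 'I_m.+1 -> T -> R) :
  dependence_index X Y m = 0%E -> (forall i, L2 X (xi i)) ->
  \det (cov_mx P (fun i => condexp Y (xi i))) = 0.
Proof.
move=> D0 xiX; have xiL i : xi i \in L by have [] := xiX i.
have cL i : condexp Y (xi i) \in L by have [] := condexp_L2 Y (xiL i).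
apply/eqP/negPn/negP => det0.
have [A A1] := cov_mx_normalize xiL (det_cov_mx_condexp_neq0 xiL det0).
have detA : \det A != 0.
  move/(congr1 determinant): A1; rewrite !det_mulmx det_tr det1.
  by apply: contra_eqN => /eqP ->; rewrite !mul0r eq_sym oner_eq0.
pose g (i : 'I_m.+1) := \sum_(j < m.+1) A i j *: xi j.
have gX i : L2 X (g i).
  rewrite /g; elim/big_rec: _ => [|j eta _]; first exact: (L2_cst X 0).
  exact: L2_lin.
have gL i : g i \in L by have [] := gX i.
pose D := \det (cov_mx P (fun i => condexp Y (g i))).
have D_gt0 : 0 < D.
  apply: det_cov_mx_gt0.
    by move=> i; have [] := condexp_L2 Y (gL i).
  by rewrite /g cov_mx_condexp_mulmx// !det_mulmx det_tr !mulf_neq0.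
have Dmem : dependence_dets X Y m D%:E.
  by exists g => //; split=> //; rewrite -A1 -cov_mx_mulmx.
(* The set of determinants contains [D], so the index is the true supremum and not the default
   value. *)
move: D0; rewrite /dependence_index ifF; last first.
  by apply/eqP => E; move: Dmem; rewrite E.
move=> E; have := ereal_sup_ubound Dmem.
by rewrite E lee_fin leNgt D_gt0.
Qed.

(** Since [E{1 | Y} = 1], the constant 1 is also spanned by [b]. Together with [m + 1] conditional
    expectations it makes [m + 2] elements in a span of [m + 1], so there is a linear relation,
    which says that a combination of the conditional expectations is constant. *)
Lemma dependence_index_eq0 (m : nat) (S : set (T -> R)) :
  L2_subspace Y S -> dim_le P S m.+1 ->
  (forall xi, L2 X xi -> S (condexp Y xi)) ->
  dependence_index X Y m = 0%E.
Proof.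
move=> [SL _ _ _] [b [bS bspan]] Scond.
have zero (xi : 'I_m.+1 -> T -> R) : (forall i, L2 X (xi i)) ->
    \det (cov_mx P (fun i => condexp Y (xi i))) = 0.
  move=> xiX; apply/det_cov_mx_eq0P => [i|].
    by have [] := SL _ (Scond _ (xiX i)).
  have [u uE] : exists u : 'I_m.+1 -> R,
      cst 1 = \sum_(i < m.+1) u i *: b i %[ae P].
    have [u uE] := bspan _ (Scond _ (L2_cst X 1)); exists u.
    apply: ae_eq_trans uE; apply/ae_eq_sym/condexp_cst_ae.
      exact: Lfun_cst.
    exact: ae_eq_refl.
  have /choice[C CE] : forall i, exists c : 'I_m.+1 -> R,
      condexp Y (xi i) = \sum_(j < m.+1) c j *: b j %[ae P].
    by move=> i; exact/bspan/Scond.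
  (* The rows are the coordinates of 1 and of the conditional expectations along [b]. There is one
     more row than columns, hence a nonzero left kernel. *)
  pose M : 'M[R]_(1 + m.+1, m.+1) := col_mx (\row_j u j) (\matrix_(i, j) C i j).
  have [v v0 vM] : exists2 v : 'rV_(1 + m.+1), v != 0 & v *m M = 0.
    have : kermx M != 0.
      rewrite kermx_eq0 /row_free neq_ltn; apply/orP; left.
      by rewrite ltnS rank_leq_col.
    by move=> /rowV0Pn[v /sub_kermxP vM v0]; exists v.
  pose w := rsubmx v; pose s := lsubmx v 0 0.
  have vM0 j : s * u j + \sum_(i < m.+1) w 0 i * C i j = 0.
    have /rowP/(_ j) := vM; rewrite -{1}(hsubmxK v) mul_row_col !mxE big_ord1.
    rewrite !mxE => vMj; rewrite -[RHS]vMj; congr (_ + _).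
      by rewrite /s !mxE.
    by apply: eq_bigr => i _; rewrite !mxE.
  have comb : cst s + \sum_(i < m.+1) w 0 i *: condexp Y (xi i) = cst 0 %[ae P].
    have {}CE : \forall x \ae P,
        forall i, condexp Y (xi i) x = (\sum_(j < m.+1) C i j *: b j) x.
      by apply: filter_forall => i; apply: filterS (CE i) => x /(_ I).
    apply: filterS2 uE CE => x /(_ I) ux Cx _.
    transitivity (s * (cst 1 x) +
        \sum_(i < m.+1) w 0 i * condexp Y (xi i) x).
      by rewrite mulr1 [X in _ + X]fct_sumE.
    rewrite ux fct_sumE mulr_sumr.
    under [X in _ + X]eq_bigr do rewrite Cx fct_sumE mulr_sumr.
    rewrite exchange_big -big_split big1// => j _ /=.
    transitivity ((s * u j + \sum_(i < m.+1) w 0 i * C i j) * b j x).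
      rewrite mulrDl mulrA; congr (_ + _).
      by rewrite mulr_suml; apply: eq_bigr => i _; rewrite mulrA.
    by rewrite vM0 mul0r.
  exists w; split; last first.
    exists (- s); apply: filterS comb => x /(_ I) h _.
    by apply/eqP; rewrite -addr_eq0 addrC; apply/eqP.
  (* If the relation involved only the constant 1, then [s = 0] almost surely, and taking
     expectations [s = 0], so [v] would vanish. *)
  apply: contra v0 => /eqP w0; apply/eqP.
  have s0 : s = 0.
    move: comb; rewrite w0 big1 ?addr0 => [s0|i _]; last by rewrite mxE scale0r.
    apply: EFin_inj; rewrite -(expectation_cst P s) -(expectation_cst P 0).
    rewrite expectation.unlock; apply: ae_eq_integral => //.
    - exact: (measurable_cst s%:E).
    - exact: (measurable_cst (0 : \bar R)).
    - exact: (ae_eq_comp EFin).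
  rewrite -(hsubmxK v) -/w w0 (_ : lsubmx v = 0) ?row_mx0//.
  by apply/matrixP => i j; rewrite !ord1 [RHS]mxE.
rewrite /dependence_index; case: ifPn => // /set0P[x0 Dx0].
have D0 x : dependence_dets X Y m x -> x = 0%E.
  by move=> [xi [xiX _] <-]; rewrite zero.
rewrite (_ : dependence_dets X Y m = [set 0%E]) ?ereal_sup1//.
apply/seteqP; split=> [x /D0|x ->]//.
by rewrite -(D0 _ Dx0).
Qed.

(** The spanning family is padded with zeros, which [dim_le] allows since it does not ask for
    freeness. *)
Lemma dim_leW (S : set (T -> R)) (n p : nat) :
  S (cst 0) -> (n <= p)%N -> dim_le P S n -> dim_le P S p.
Proof.
move=> S0 /subnKC <-; set q := (p - n)%N => -[b [bS bspan]].
exists (fun i => if fintype.split i is inl j then b j else cst 0).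
split=> [i|xi /bspan[c cE]]; first by case: fintype.split.
exists (fun i => if fintype.split i is inl j then c j else 0).
apply: ae_eq_trans cE _; apply: aeW => x _; congr (_ x).
rewrite big_split_ord/= [X in _ = _ + X]big1 ?addr0 => [|i _].
  by apply: eq_bigr => i _; rewrite (unsplitK (inl i)).
by rewrite (unsplitK (inr i)) scale0r.
Qed.

(** Choose a family whose conditional expectations have nonsingular covariance and such that no
    family with one more member does. These [k] conditional expectations and the constant 1 span
    [S]: adjoining any further [eta] creates a relation that can be solved for [E{eta | Y}]. *)
Lemma exists_condexp_subspace (m : nat) : dependence_index X Y m = 0%E ->
  exists S : set (T -> R),
    [/\ L2_subspace Y S, dim_le P S m.+1 &
        forall xi, L2 X xi -> S (condexp Y xi)].
Proof.
move=> D0.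
pose Q k := exists xi : 'I_k -> T -> R, (forall i, L2 X (xi i)) /\
  \det (cov_mx P (fun i => condexp Y (xi i))) != 0.
(* [Q 0] holds because the empty determinant is 1, and [Q m.+1] fails because the index is 0. The
   bound [k <= m] leaves room for the constant among [m + 1] generators. *)
have [k [km [xi [xiX detxi]] NQ]] : exists k, [/\ (k <= m)%N, Q k & ~ Q k.+1].
  apply: contrapT => H.
  have QS k : (k <= m.+1)%N -> Q k.
    elim: k => [_|k IH km].
      exists (fun=> cst 0); split; first by move=> [].
      by rewrite det_mx00 oner_neq0.
    by apply: contrapT => NQ; apply: H; exists k; split => //; exact/IH/ltnW.
  have [xi [xiX]] := QS _ (leqnn _).
  by rewrite det_cov_mx_condexp_eq0// eqxx.
have xiL i : xi i \in L by have [] := xiX i.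
pose b (i : 'I_k.+1) :=
  if unlift ord0 i is Some j then condexp Y (xi j) else cst 1.
have b0 : b ord0 = cst 1 by rewrite /b unlift_none.
have bS j : b (lift ord0 j) = condexp Y (xi j) by rewrite /b liftK.
have bY i : L2 Y (b i).
  by rewrite /b; case: unlift => [j|]; [exact: condexp_L2|exact: L2_cst].
pose S : set (T -> R) := [set eta | L2 Y eta /\
  exists c : 'I_k.+1 -> R, eta = \sum_(i < k.+1) c i *: b i %[ae P]].
have S0 : S (cst 0).
  split; first exact: L2_cst.
  exists (fun=> 0); rewrite big1; first exact: ae_eq_refl.
  by move=> i _; rewrite scale0r.
exists S; split.
- split => //.
  + by move=> eta [].
  + move=> a eta eta' [etaY [c cE]] [etaY' [c' cE']].
    split; first exact: L2_lin.
    exists (fun i => a * c i + c' i).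
    under eq_bigr do rewrite scalerDl -scalerA.
    rewrite big_split/= -scaler_sumr.
    apply: filterS2 cE cE' => x /(_ I) h /(_ I) h' _.
    by rewrite !fctE h h'.
  + move=> eta eta' [_ [c cE]] etaY' ee'; split => //; exists c.
    exact: ae_eq_trans (ae_eq_sym ee') cE.
- apply: (@dim_leW _ k.+1) => //; exists b; split; last by move=> eta [].
  move=> i; split => //; exists (fun j => (j == i)%:R).
  rewrite (bigD1 i)//= eqxx scale1r big1 ?addr0; first exact: ae_eq_refl.
  by move=> j /negbTE ->; rewrite scale0r.
- move=> eta etaX; have etaL : eta \in L by have [] := etaX.
  split; first exact: condexp_L2.
  pose f (i : 'I_k.+1) := if unlift ord0 i is Some j then xi j else eta.
  have fX i : L2 X (f i) by rewrite /f; case: unlift.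
  have : \det (cov_mx P (fun i => condexp Y (f i))) = 0.
    by apply/eqP/negPn/negP => detf; apply: NQ; exists f.
  move/det_cov_mx_eq0P; case.
    by move=> i; have [fL _] := fX i; have [] := condexp_L2 Y fL.
  move=> v [v0 [c]]; rewrite big_ord_recl /f unlift_none.
  under eq_bigr do rewrite liftK.
  move=> vc.
  (* Otherwise the relation would concern the [condexp Y (xi j)] alone and contradict [detxi]. *)
  have v00 : v 0 ord0 != 0.
    apply: contra detxi => /eqP v00; apply/eqP/det_cov_mx_eq0P.
      by move=> i; have [] := condexp_L2 Y (xiL i).
    exists (\row_j v 0 (lift ord0 j)); split.
      apply: contra v0 => /eqP/rowP v0; apply/eqP/rowP => i; rewrite mxE.
      by case: (unliftP ord0 i) => [j ->|->//]; have := v0 j; rewrite !mxE.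
    exists c; under eq_bigr do rewrite mxE.
    by move: vc; rewrite v00 scale0r add0r.
  (* Coefficients obtained by solving the relation for [condexp Y eta]; the one at [ord0] multiplies
     the constant 1. *)
  exists (fun i => if unlift ord0 i is Some j
    then - (v 0 ord0)^-1 * v 0 (lift ord0 j) else (v 0 ord0)^-1 * c).
  rewrite big_ord_recl b0 unlift_none.
  under eq_bigr do rewrite bS liftK -scalerA.
  rewrite -scaler_sumr; apply: filterS vc => x /(_ I) + _.
  set s := \sum_(i < k) _ => vx.
  have {}vx : v 0 ord0 * condexp Y eta x + s x = c by exact: vx.
  transitivity ((v 0 ord0)^-1 * c * 1 - (v 0 ord0)^-1 * s x); last first.
    by rewrite -mulNr.
  by rewrite -vx mulr1 -mulrBr addrK mulKf.
Qed.

End dependence_index_zero.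

Theorem theorem2 (R : realType) (d dX dY : measure_display)
    (T : measurableType d) (TX : measurableType dX) (TY : measurableType dY)
    (P : probability T R) (X : {RV P >-> TX}) (Y : {RV P >-> TY}) (m : nat) :
  dependence_index X Y m = 0%E <->
  exists S : set (T -> R),
    [/\ L2_subspace Y S,
        dim_le P S m.+1 &
        forall xi : T -> R, L2 X xi -> S (condexp Y xi)].
Proof.
split; first exact: exists_condexp_subspace.
by move=> [S [S1 S2 S3]]; exact: dependence_index_eq0 S1 S2 S3.
Qed.
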